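(* Let $\mathbb F$ be a field with at least $3$ elements and let $A$ be a GKŻ algebra over $\mathbb F$. If $A$ has an ideal of codimension $1$ (equivalently, if there exists a linear functional $\Lambda:A\to\mathbb F$ with $\Lambda(u)\neq 0$ for every unit $u$ of $A$), then $A$ is generated by units.
   Context: All algebras are nonzero, associative, unital, not necessarily commutative. $\mathcal U(A)$ denotes the group of units (invertible elements) of $A$. A unital algebra $A$ over a field $\mathbb F$ is a GKŻ algebra if every linear functional $\Lambda:A\to\mathbb F$ such that $\Lambda(u)\neq0$ for all $u\in\mathcal U(A)$ and $\Lambda(\mathbf 1_A)=1$ is multiplicative, i.e. $\Lambda(ab)=\Lambda(a)\Lambda(b)$ for all $a,b\in A$. $A$ is generated by units if $A=\operatorname{span}_{\mathbb F}(\mathcal U(A))$; equivalently, every element of $A$ is a finite sum of units. Ideal means two-sided ideal. *)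

(* Defs.v *)
From mathcomp Require Import all_boot all_algebra.

Set Implicit Arguments.
Unset Strict Implicit.
Unset Printing Implicit Defensive.

Import GRing.Theory.
Local Open Scope ring_scope.

Definition nonvanishing_on_units (F : fieldType) (A : unitAlgType F)
    (L : {scalar A}) : Prop :=
  forall u : A, u \is a GRing.unit -> L u != 0.

Definition GKZ_algebra (F : fieldType) (A : unitAlgType F) : Prop :=
  forall L : {scalar A}, nonvanishing_on_units L -> L 1 = 1 ->
    forall a b : A, L (a * b) = L a * L b.

(* Closure under scaling follows from c *: x = (c *: 1) * x. *)
Definition two_sided_ideal (F : fieldType) (A : unitAlgType F)
    (I : {pred A}) : Prop :=
  [/\ zmod_closed I,
      forall a x : A, x \in I -> a * x \in I
    & forall a x : A, x \in I -> x * a \in I].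

(* dim (A / I) = 1: the class of some v is nonzero and spans the quotient. *)
Definition codim1 (F : fieldType) (A : unitAlgType F) (I : {pred A}) : Prop :=
  exists2 v : A, v \notin I & forall x : A, exists c : F, x - c *: v \in I.

Definition has_codim1_ideal (F : fieldType) (A : unitAlgType F) : Prop :=
  exists2 I : {pred A}, two_sided_ideal I & codim1 I.

Definition generated_by_units (F : fieldType) (A : unitAlgType F) : Prop :=
  forall x : A, exists (n : nat) (c : 'I_n -> F) (u : 'I_n -> A),
    (forall i, u i \is a GRing.unit) /\ x = \sum_(i < n) c i *: u i.

(* Main.v *)
(** Fix a functional [L] that does not vanish on units, normalised by [L 1 = 1].
    If the span of the units is proper, Zorn's lemma gives a functional [f <> 0]
    vanishing on it.  Each [L + t f] agrees with [L] on units, hence is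
    multiplicative by the GKZ property; comparing coefficients of [t] and [t^2]
    at [t = 1] and at some [t] other than [0] and [1] yields [f a * f b = 0] for
    all [a], [b], so [f = 0]. *)
From HB Require Import structures.
Require Import Defs.
From mathcomp Require Import boolp classical_sets.
From mathcomp Require Import all_boot all_algebra.

Import GRing.Theory.
Local Open Scope ring_scope.

Definition subspace {F : fieldType} {V : lmodType F} (P : V -> Prop) : Prop :=
  P 0 /\ forall (a : F) (u v : V), P u -> P v -> P (a *: u + v).

Section Subspaces.
Variables (F : fieldType) (V : lmodType F).
Implicit Types (P S : V -> Prop) (v x y : V) (a c : F).

Lemma subspaceZ P a v : subspace P -> P v -> P (a *: v).
Proof. by case=> P0 PD Pv; rewrite -[a *: v]addr0; apply: PD. Qed.

Lemma subspaceD P x y : subspace P -> P x -> P y -> P (x + y).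
Proof. by case=> _ PD Px Py; rewrite -[x]scale1r; apply: PD. Qed.

Lemma subspaceB P x y : subspace P -> P x -> P y -> P (x - y).
Proof.
by move=> sP Px Py; apply: subspaceD => //; rewrite -scaleN1r; apply: subspaceZ.
Qed.

(** The coefficient [c] is unique: two different values would put a nonzero multiple of [v], hence
    [v] itself, in [P]. Uniqueness makes the chosen coefficient linear in [y]. *)
Lemma hyperplane_functional P v :
    subspace P -> ~ P v -> (forall y, exists c, P (y - c *: v)) ->
  exists f : {scalar V}, f v = 1 /\ forall y, P y <-> f y = 0.
Proof.
move=> sP Pv /choice[f Pf].
have f_uniq y c : P (y - c *: v) -> f y = c.
  move=> Pc; apply/eqP; rewrite -subr_eq0; apply: contra_notT Pv => fc_neq0.
  have /(subspaceZ P (f y - c)^-1 _ sP) := subspaceB P _ _ sP Pc (Pf y).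
  have -> : y - c *: v - (y - f y *: v) = (f y - c) *: v.
    by rewrite opprB addrC addrA subrK -scalerBl.
  by rewrite scalerA mulVf// scale1r.
have f_lin : scalar f.
  move=> a x y; apply: f_uniq.
  rewrite scalerDl -scalerA opprD addrACA -scalerBr.
  by case: (sP) => _; apply.
pose g : {scalar V} := HB.pack f (GRing.isLinear.Build _ _ _ _ f f_lin).
exists g; split=> [|y].
  by apply: f_uniq; rewrite scale1r subrr; case: sP.
split=> [Py|gy0]; first by apply: f_uniq; rewrite scale0r subr0.
by have := Pf y; rewrite [f y]gy0 scale0r subr0.
Qed.

(** Zorn's lemma yields [M] maximal among the subspaces that contain [S] and miss [x]; maximality
    forces [M] and [x] to span [V]. *)
Lemma maximal_subspace_avoiding S x : subspace S -> ~ S x ->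
  exists M : V -> Prop, [/\ subspace M, forall y, S y -> M y, ~ M x
    & forall y, exists c, M (y - c *: x)].
Proof.
move=> sS Sx.
(* Adjoining [S] by hand lets the empty chain have the empty set as its union. *)
pose U (X : set V) y := S y \/ X y.
pose good : set (set V) := fun X => subspace (U X) /\ ~ U X x.
have [C good_C chain_C|X [[sU Ux] maxX]] := @Zorn_bigcup V good.
  have UC X y : C X -> U X y -> U (\bigcup_(Y in C) Y)%classic y.
    by move=> CX [Sy|Xy]; [left|right; exists X].
  (* Chain members are comparable, so two points not both in [S] lie in a single [U X], where linear
     combinations can be formed. *)
  have UC_common y z : U (\bigcup_(Y in C) Y)%classic y ->
      U (\bigcup_(Y in C) Y)%classic z ->
      (S y /\ S z) \/ exists2 X, C X & U X y /\ U X z.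
    move=> [Sy|[X CX Xy]] [Sz|[Y CY Yz]]; first by left.
    - by right; exists Y => //; split; [left|right].
    - by right; exists X => //; split; [right|left].
    right; have [XY|YX] := chain_C _ _ CX CY.
      by exists Y => //; split; right => //; apply: XY.
    by exists X => //; split; right => //; apply: YX.
  split; last by move=> [//|[X CX Xx]]; case: (good_C _ CX) => _; apply; right.
  split; first by left; case: sS.
  move=> a u v Uu Uv; have [[Su Sv]|[X CX [Xu Xv]]] := UC_common _ _ Uu Uv.
    by left; case: sS => _; apply.
  by apply: (UC X) => //; case: (good_C _ CX) => -[_ UD] _; apply: UD.
exists (U X); split=> // [y Sy|y]; first by left.
apply: contrapT => no_c.
(* The span of [U X] and [y]. It is strictly larger than [X], since otherwise [c = 0] would serve,
   so maximality is contradicted once [N] is shown to miss [x]. *)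
pose N : set V := fun z => exists m a, U X m /\ z = m + a *: y.
have XN z : U X z -> N z by exists z, 0; rewrite scale0r addr0.
have UN z : U N z -> N z by move=> [Sz|//]; apply: XN; left.
apply: (maxX N).
  split=> [z Xz|]; first by apply: XN; right.
  move=> NX; apply: no_c; exists 0; rewrite scale0r subr0; right; apply: NX.
  by exists 0, 1; rewrite scale1r add0r; split=> //; case: sU.
split.
  split; first by left; case: sS.
  move=> a u v /UN[m [b [Um ->]]] /UN[n [c [Un ->]]]; right.
  exists (a *: m + n), (a * b + c); split; first by case: sU => _; apply.
  by rewrite scalerDr scalerA scalerDl addrACA.
move=> /UN[m [a [Um xE]]]; have [a0|a0] := eqVneq a 0.
  by apply: Ux; rewrite xE a0 scale0r addr0.
(* Solving [x = m + a *: y] for [y] gives [y - a^-1 *: x = - a^-1 *: m]. *)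
apply: no_c; exists a^-1.
rewrite xE scalerDr scalerA mulVf// scale1r opprD addrCA subrr addr0.
by rewrite -scaleNr; apply: subspaceZ.
Qed.

Lemma separating_functional S x : subspace S -> ~ S x ->
  exists f : {scalar V}, f x = 1 /\ forall y, S y -> f y = 0.
Proof.
move=> sS /(maximal_subspace_avoiding _ _ sS)[M [sM SM Mx Mgen]].
have [f [fx fM]] := hyperplane_functional M x sM Mx Mgen.
by exists f; split=> // y /SM /fM.
Qed.

End Subspaces.

Section Units.
Variables (F : fieldType) (A : unitAlgType F).

(** Repeats the condition of [generated_by_units] verbatim, so that its failure at [x] is
    [~ unit_span x] by conversion. *)
Definition unit_span (x : A) : Prop :=
  exists (n : nat) (c : 'I_n -> F) (u : 'I_n -> A),
    (forall i, u i \is a GRing.unit) /\ x = \sum_(i < n) c i *: u i.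

Lemma unit_span_subspace : subspace unit_span.
Proof.
split.
  by exists 0%N, (fun=> 0), (fun=> 1); rewrite big_ord0; split=> // -[].
move=> a _ _ [m [c [u [uU ->]]]] [n [d [w [wU ->]]]].
pose glue T (f : 'I_m -> T) (g : 'I_n -> T) (i : 'I_(m + n)) :=
  match split i with inl j => f j | inr k => g k end.
have glueL T f g i : glue T f g (lshift n i) = f i.
  by rewrite /glue (unsplitK (inl i)).
have glueR T f g i : glue T f g (rshift m i) = g i.
  by rewrite /glue (unsplitK (inr i)).
exists (m + n)%N, (glue F (fun i => a * c i) d), (glue A u w); split.
  by move=> i; rewrite /glue; case: split.
rewrite big_split_ord /= scaler_sumr; congr (_ + _); apply: eq_bigr => i _.
  by rewrite !glueL scalerA.
by rewrite !glueR.
Qed.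

Lemma unit_span_unit (u : A) : u \is a GRing.unit -> unit_span u.
Proof.
move=> uU; exists 1%N, (fun=> 1), (fun=> u); split=> //.
by rewrite big_ord1 scale1r.
Qed.

(** An ideal containing a unit contains everything, [v] included, so the functional with kernel [I]
    is nonzero on units. *)
Lemma codim1_ideal_nonvanishing : has_codim1_ideal A ->
  exists L : {scalar A}, nonvanishing_on_units L.
Proof.
case=> I [[I0 IB] IMl IMr] [v vI Iv].
have sI : subspace (fun y => y \in I).
  split=> // a x y xI yI.
  rewrite -[y]opprK; apply: (IB); first by rewrite -mulr_algl; apply: IMl.
  by rewrite -sub0r; apply: IB.
have vI' : ~ v \in I by apply/negP.
have [L [Lv LI]] := hyperplane_functional F A _ v sI vI' Iv.
exists L => u uU; apply/eqP => /LI uI; apply: vI'.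
by rewrite -[v](mulrVK uU); apply: IMl.
Qed.

Lemma nonvanishing_normalize (L : {scalar A}) : nonvanishing_on_units L ->
  exists2 M : {scalar A}, nonvanishing_on_units M & M 1 = 1.
Proof.
move=> LU; have L1 := LU 1 (unitr1 A).
pose f x := (L 1)^-1 * L x.
have f_lin : scalar f.
  by move=> a x y; rewrite /f linearP mulrDr mulrCA.
pose M : {scalar A} := HB.pack f (GRing.isLinear.Build _ _ _ _ f f_lin).
exists M.
  by move=> u uU; apply: mulf_neq0; [rewrite invr_eq0|apply: LU].
exact: mulVf.
Qed.

(** The ideal is the kernel of [L]; the class of [1] spans the quotient because [L] kills
    [x - L x *: 1]. *)
Lemma multiplicative_codim1_ideal (L : {scalar A}) :
    L 1 = 1 -> (forall a b, L (a * b) = L a * L b) -> has_codim1_ideal A.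
Proof.
move=> L1 LM; exists (fun x => L x == 0).
  split=> [|a x|a x]; rewrite ?unfold_in; last 2 first.
  - by rewrite LM => /eqP->; rewrite mulr0.
  - by rewrite LM => /eqP->; rewrite mul0r.
  split=> [|x y]; rewrite !unfold_in ?linear0// linearB.
  by move=> /eqP-> /eqP->; rewrite subr0.
exists 1; first by rewrite unfold_in L1 oner_neq0.
by move=> x; exists (L x); rewrite unfold_in linearB linearZ /= L1 mulr1 subrr.
Qed.

Lemma GKZ_perturbation (L f : {scalar A}) : GKZ_algebra A ->
    nonvanishing_on_units L -> L 1 = 1 ->
    (forall u, u \is a GRing.unit -> f u = 0) ->
  forall t a b, t * f (a * b) =
    t * (L a * f b + f a * L b) + t ^+ 2 * (f a * f b).
Proof.
move=> hA LU L1 fU t a b.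
pose g x := L x + t * f x.
have g_lin : scalar g.
  by move=> c x y; rewrite /g !linearP !mulrDr addrACA mulrCA.
pose M : {scalar A} := HB.pack g (GRing.isLinear.Build _ _ _ _ g g_lin).
have gU u : u \is a GRing.unit -> g u = L u.
  by move=> uU; rewrite /g fU// mulr0 addr0.
have MU : nonvanishing_on_units M.
  by move=> u uU; rewrite [M u]gU//; apply: LU.
have M1 : M 1 = 1 by rewrite -L1; apply: gU; apply: unitr1.
have : g (a * b) = g a * g b := hA M MU M1 a b.
(* Multiplicativity of [L] itself makes the terms free of [t] cancel. *)
rewrite /g (hA L LU L1) mulrDl !mulrDr -!addrA => /addrI ->.
by rewrite expr2 !mulrA [L a * t]mulrC [t * f a * t]mulrAC.
Qed.

End Units.

Theorem theorem2p1 (F : fieldType) (A : unitAlgType F)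
    (hF : exists s : seq F, uniq s /\ (3 <= size s)%N)
    (hA : GKZ_algebra A) :
  (has_codim1_ideal A <->
     exists L : {scalar A}, nonvanishing_on_units L) /\
  (has_codim1_ideal A -> generated_by_units A).
Proof.
split; first split.
- exact: codim1_ideal_nonvanishing.
- move=> [_ /nonvanishing_normalize[L LU L1]].
  exact: multiplicative_codim1_ideal L1 (hA L LU L1).
move=> /codim1_ideal_nonvanishing[_ /nonvanishing_normalize[L LU L1]] x.
apply: contrapT => xS.
have [f [fx fS]] := separating_functional F A _ x (unit_span_subspace F A) xS.
have fU u : u \is a GRing.unit -> f u = 0.
  by move=> uU; apply: fS; apply: unit_span_unit.
have [t t0 t1] : exists2 t : F, t != 0 & t != 1.
  have [s [s_uniq s_size]] := hF.
  (* Three distinct elements cannot all lie in a list of length two. *)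
  have : ~~ all (mem [:: 0; 1 : F]) s.
    apply/negP => /allP s_sub.
    by have := leq_trans s_size (uniq_leq_size s_uniq s_sub).
  move=> /allPn[t _]; rewrite /= !inE negb_or => /andP[t0 t1].
  by exists t.
have fP := GKZ_perturbation F A L f hA LU L1 fU.
(* With [a = b = x] and [f x = 1], the case of coefficient [1] gives [f (x * x) = L x + L x + 1].
   Substituted into the case of [t], it leaves [t = t ^+ 2], which contradicts the choice of [t]. *)
have := fP t x x; have := fP 1 x x; rewrite !mul1r expr1n mul1r fx mulr1 => ->.
rewrite mulrDr !mulr1 expr2 => /addrI; rewrite -{1}[t]mulr1 => /(mulfI t0)/eqP.
by rewrite eq_sym (negbTE t1).
Qed.
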